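(* Let $\Omega$ be a square grid domain with edge set $\mathcal{E}$ and boundary edges $\partial\mathcal{E}$, and let $\mathfrak{b}\subset\partial\mathcal{E}$ be a collection of boundary edges. For any $u\in\mathcal{R}^{\mathfrak{b}}_\Omega$, there exists a unique $v\in\mathcal{I}^{\mathfrak{b}}_\Omega$ such that $u+v$ has an s-holomorphic extension $h:\mathcal{E}\to\mathbb{C}$ satisfying $h\parallel\tau_{cw}^{-1/2}$ on $\partial\mathcal{E}\setminus\mathfrak{b}$.
   Context: A square grid domain is a finite simply connected union of faces of $\mathbb{Z}^2$, whose boundary is a simple closed curve; edges are identified with their midpoints in $\mathbb{C}$. For a boundary edge $z$, $\tau_{cw}(z)\in\{\pm1,\pm i\}$ is the unit tangent of the clockwise-oriented boundary at $z$, and $\tau_{ccw}=-\tau_{cw}$. The notation $f(z)\parallel\tau(z)^{-1/2}$ means that $f(z)$ is a real multiple of $\tau(z)^{-1/2}$. $\mathcal{R}^{\mathfrak{b}}_\Omega$ is the real vector space of functions $f:\mathfrak{b}\to\mathbb{C}$ with $f\parallel\tau_{ccw}^{-1/2}$ on $\mathfrak{b}$, and $\mathcal{I}^{\mathfrak{b}}_\Omega$ the space of functions $f:\mathfrak{b}\to\mathbb{C}$ with $f\parallel\tau_{cw}^{-1/2}$ on $\mathfrak{b}$. With $\lambda=e^{i\pi/4}$, $F:\mathcal{E}\to\mathbb{C}$ is s-holomorphic if for every face of $\Omega$, with center $c$ and edges $E=c+\frac12$, $N=c+\frac i2$, $W=c-\frac12$, $S=c-\frac i2$: $F(N)+\lambda\overline{F(N)}=F(E)+\lambda\overline{F(E)}$,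 $F(N)+\lambda^{-1}\overline{F(N)}=F(W)+\lambda^{-1}\overline{F(W)}$, $F(S)+\lambda^{3}\overline{F(S)}=F(E)+\lambda^{3}\overline{F(E)}$, $F(S)+\lambda^{-3}\overline{F(S)}=F(W)+\lambda^{-3}\overline{F(W)}$. *)

(* Defs.v *)
(* The complex plane is R[i], for an arbitrary R : realType. *)
From mathcomp Require Import all_boot all_order all_algebra finmap.
From mathcomp Require Import complex.
From mathcomp Require Import all_classical all_reals all_analysis.

Set Implicit Arguments.
Unset Strict Implicit.
Unset Printing Implicit Defensive.

Import Order.TTheory GRing.Theory Num.Theory.
Import numFieldNormedType.Exports.

Local Open Scope fset_scope.
Local Open Scope classical_set_scope.
Local Open Scope ring_scope.

Definition topological_boundary (T : topologicalType) (A : set T) : set T :=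
  closure A `\` interior A.

Definition simple_closed_curve (R : realType) (T : topologicalType)
    (A : set T) : Prop :=
  exists g : R -> T,
    [/\ {within `[0, 1], continuous g},
        g 0 = g 1,
        {in `[0, 1[ &, injective g} &
        g @` `[0, 1] = A].
Arguments simple_closed_curve R {T} A.

Definition path_in (R : realType) (T : topologicalType) (A : set T)
    (g : R -> T) : Prop :=
  {within `[0, 1], continuous g} /\ g @` `[0, 1] `<=` A.

(* In the null-homotopy H the first variable is the homotopy parameter, and
   the base point g 0 is kept fixed. *)
Definition simply_connected (R : realType) (T : topologicalType)
    (A : set T) : Prop :=
  [/\ A !=set0,
      (forall x y : T, A x -> A y ->
         exists g : R -> T, [/\ path_in A g, g 0 = x & g 1 = y]) &
      (forall g : R -> T, path_in A g -> g 0 = g 1 ->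
         exists H : R * R -> T,
           [/\ {within `[0, 1] `*` `[0, 1], continuous H},
               H @` (`[0, 1] `*` `[0, 1]) `<=` A,
               (forall t, t \in `[0, 1] -> H (0, t) = g t),
               (forall t, t \in `[0, 1] -> H (1, t) = g 0) &
               (forall s, s \in `[0, 1] -> H (s, 0) = g 0 /\ H (s, 1) = g 0)])].
Arguments simply_connected R {T} A.

(* The face of the square lattice with lower left vertex m + i n is encoded by
   (m, n); edges are represented by their midpoints. *)
Definition face_center (R : realType) (p : int * int) : R[i] :=
  (p.1%:~R + 2^-1) + 'i%C * (p.2%:~R + 2^-1).

Definition edgeE (R : realType) (p : int * int) : R[i] := face_center R p + 2^-1.
Definition edgeN (R : realType) (p : int * int) : R[i] := face_center R p + 'i%C / 2.
Definition edgeW (R : realType) (p : int * int) : R[i] := face_center R p - 2^-1.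
Definition edgeS (R : realType) (p : int * int) : R[i] := face_center R p - 'i%C / 2.

Definition face_edges (R : realType) (p : int * int) : {fset R[i]} :=
  [fset edgeE R p; edgeN R p; edgeW R p; edgeS R p].

Definition closed_face (R : realType) (p : int * int) :
    set (R[i] : numClosedFieldType) :=
  [set z | (p.1%:~R <= complex.Re z <= (p.1 + 1)%:~R) /\
           (p.2%:~R <= complex.Im z <= (p.2 + 1)%:~R)].
Arguments closed_face R p : clear implicits.

Definition region (R : realType) (Omega : {fset int * int}) :
    set (R[i] : numClosedFieldType) :=
  \bigcup_(p in [set` Omega]) closed_face R p.
Arguments region R Omega : clear implicits.

Definition square_grid_domain (R : realType) (Omega : {fset int * int}) : Prop :=
  simply_connected R (region R Omega) /\
  simple_closed_curve R (topological_boundary (region R Omega)).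

Definition edges (R : realType) (Omega : {fset int * int}) : {fset R[i]} :=
  (\bigcup_(p <- Omega) face_edges R p)%fset.

(* The edges lying on the topological boundary of the region are those that
   bound exactly one face of Omega. *)
Definition boundary_edges (R : realType) (Omega : {fset int * int}) :
    {fset R[i]} :=
  [fset z in edges R Omega |
    #|` [fset p in Omega | z \in face_edges R p]| == 1%N].

(* Clockwise orientation: the domain lies on the right-hand side of its
   boundary.  The values outside boundary_edges are irrelevant. *)
Definition tau_cw (R : realType) (Omega : {fset int * int}) (z : R[i]) : R[i] :=
  if z \in [fset edgeE R p | p in Omega] then - 'i%C
  else if z \in [fset edgeN R p | p in Omega] then 1
  else if z \in [fset edgeW R p | p in Omega] then 'i%C
  else -1.

Definition tau_ccw (R : realType) (Omega : {fset int * int}) (z : R[i]) : R[i] :=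
  - tau_cw Omega z.

(* f is a real multiple of tau^(-1/2); the two square roots of tau^-1 differ by
   a sign, so it does not matter which one is taken. *)
Definition parallel_invsqrt (R : realType) (f tau : R[i]) : Prop :=
  exists (w : R[i]) (r : R), w ^+ 2 = tau^-1 /\ f = r%:C%C * w.

Definition Rspace (R : realType) (Omega : {fset int * int}) (b : {fset R[i]}) :
    set {ffun b -> R[i]} :=
  [set u | forall z : b, parallel_invsqrt (u z) (tau_ccw Omega (val z))].
Arguments Rspace {R} Omega b _.

Definition Ispace (R : realType) (Omega : {fset int * int}) (b : {fset R[i]}) :
    set {ffun b -> R[i]} :=
  [set v | forall z : b, parallel_invsqrt (v z) (tau_cw Omega (val z))].
Arguments Ispace {R} Omega b _.

Definition lambda (R : realType) : R[i] :=
  (cos (pi / 4) +i* sin (pi / 4))%C.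

Definition s_holomorphic (R : realType) (Omega : {fset int * int})
    (F : {ffun edges R Omega -> R[i]}) : Prop :=
  forall p, p \in Omega -> forall E N W S : edges R Omega,
    val E = edgeE R p -> val N = edgeN R p ->
    val W = edgeW R p -> val S = edgeS R p ->
    [/\ F N + lambda R * (F N)^*%C = F E + lambda R * (F E)^*%C,
        F N + (lambda R)^-1 * (F N)^*%C = F W + (lambda R)^-1 * (F W)^*%C,
        F S + lambda R ^+ 3 * (F S)^*%C = F E + lambda R ^+ 3 * (F E)^*%C &
        F S + lambda R ^- 3 * (F S)^*%C = F W + lambda R ^- 3 * (F W)^*%C].

Definition extends (R : realType) (Omega : {fset int * int}) (b : {fset R[i]})
    (h : {ffun edges R Omega -> R[i]}) (f : {ffun b -> R[i]}) : Prop :=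
  forall (z : b) (e : edges R Omega), val e = val z -> h e = f z.

(* Main.v *)
(* Each s-holomorphicity equation is one real linear equation.  The 4 equations
   per face, together with one real equation per boundary edge z (prescribing
   the component of h(z) orthogonal to tau_cw(z)^(-1/2)), are exactly as many
   as the 2 |E| real unknowns, because an edge bounds two faces, or one if it is
   a boundary edge.  Existence therefore follows from uniqueness.

   For uniqueness, let h be s-holomorphic with h parallel to tau_cw^(-1/2) on the
   whole boundary.  Then the sum of h^2 tau_cw over the boundary is the sum of
   |h|^2.  It is also the sum over the faces of the clockwise contour sums of
   h^2 tau, since interior edges cancel, and s-holomorphicity makes the real part
   of the contour sum of a face equal to -sqrt 2 |h(E) - h(W)|^2.  Hence h = 0 on
   the boundary and h(E) = h(W) on each face; moving right along a row of faces
   until the boundary gives h = 0. *)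
From HB Require Import structures.
Require Import Defs.
From mathcomp Require Import all_boot all_order all_algebra finmap.
From mathcomp Require Import complex.
From mathcomp Require Import all_classical all_reals all_analysis.
From mathcomp Require Import ring lra zify.
Import Order.TTheory GRing.Theory Num.Theory.
Local Open Scope ring_scope.

Set Implicit Arguments.
Unset Strict Implicit.
Unset Printing Implicit Defensive.

(** * Coordinates and directions of edge midpoints *)

Section Lattice.
Variable R : realType.
Implicit Types p q : int * int.

Lemma complex_addE (a b c d : R) :
  (a +i* b)%C + (c +i* d)%C = ((a + c) +i* (b + d))%C.
Proof. by []. Qed.

Lemma complex_oppE (a b : R) : - (a +i* b)%C = ((- a) +i* (- b))%C.
Proof. by []. Qed.

Lemma complex_mulE (a b c d : R) :
  (a +i* b)%C * (c +i* d)%C = ((a * c - b * d) +i* (a * d + b * c))%C.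
Proof. by []. Qed.

Lemma complex_intE (m : int) : m%:~R = (m%:~R +i* 0)%C :> R[i].
Proof. by rewrite -(rmorph_int (real_complex R)). Qed.

Lemma complex_halfE : 2^-1 = (2^-1 +i* 0)%C :> R[i].
Proof. by rewrite -(rmorph_nat (real_complex R) 2) -fmorphV. Qed.

Definition complexE_rules :=
  (complex_addE, complex_oppE, complex_mulE, complex_intE, complex_halfE).

Lemma edgeE_coord p :
  edgeE R p = ((p.1%:~R + 1) +i* (p.2%:~R + 2^-1))%C.
Proof.
by rewrite /edgeE /face_center !complexE_rules; congr Complex; field.
Qed.

Lemma edgeN_coord p :
  edgeN R p = ((p.1%:~R + 2^-1) +i* (p.2%:~R + 1))%C.
Proof.
by rewrite /edgeN /face_center !complexE_rules; congr Complex; field.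
Qed.

Lemma edgeW_coord p : edgeW R p = (p.1%:~R +i* (p.2%:~R + 2^-1))%C.
Proof.
by rewrite /edgeW /face_center !complexE_rules; congr Complex; field.
Qed.

Lemma edgeS_coord p : edgeS R p = ((p.1%:~R + 2^-1) +i* p.2%:~R)%C.
Proof.
by rewrite /edgeS /face_center !complexE_rules; congr Complex; field.
Qed.

Definition edge_coord := (edgeE_coord, edgeN_coord, edgeW_coord, edgeS_coord).

Lemma edgeE_inj : injective (edgeE R).
Proof.
by move=> [a b] [c d]; rewrite !edge_coord => -[/= /addIr/intr_inj-> /addIr/intr_inj->].
Qed.

Lemma edgeN_inj : injective (edgeN R).
Proof.
by move=> [a b] [c d]; rewrite !edge_coord => -[/= /addIr/intr_inj-> /addIr/intr_inj->].
Qed.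

Lemma edgeW_inj : injective (edgeW R).
Proof.
by move=> [a b] [c d]; rewrite !edge_coord => -[/= /intr_inj-> /addIr/intr_inj->].
Qed.

Lemma edgeS_inj : injective (edgeS R).
Proof.
by move=> [a b] [c d]; rewrite !edge_coord => -[/= /addIr/intr_inj-> /intr_inj->].
Qed.

Lemma int_add_half_neq (m n : int) : m%:~R + 2^-1 != n%:~R :> R.
Proof.
apply/eqP => mn; have : 2 * m + 1 = 2 * n; last by lia.
by apply/eqP; rewrite -(eqr_int R) intrD !intrM -mn; apply/eqP; field.
Qed.

(** Midpoints of vertical edges have an integer real part, those of horizontal edges a half-integer
    one, so no E or W edge coincides with an N or S edge. *)
Definition vertical_edge (z : R[i]) : bool :=
  `[< exists m : int, complex.Re z = m%:~R >].

Lemma edgeE_vertical p : vertical_edge (edgeE R p).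
Proof. by apply/asboolP; exists (p.1 + 1); rewrite edge_coord intrD. Qed.

Lemma edgeW_vertical p : vertical_edge (edgeW R p).
Proof. by apply/asboolP; exists p.1; rewrite edge_coord. Qed.

Lemma edgeN_horizontal p : vertical_edge (edgeN R p) = false.
Proof.
apply/asboolP => -[m]; rewrite edge_coord /= => /eqP.
by rewrite (negPf (int_add_half_neq _ _)).
Qed.

Lemma edgeS_horizontal p : vertical_edge (edgeS R p) = false.
Proof.
apply/asboolP => -[m]; rewrite edge_coord /= => /eqP.
by rewrite (negPf (int_add_half_neq _ _)).
Qed.

Definition edge_direction := (edgeE_vertical, edgeW_vertical,
  edgeN_horizontal, edgeS_horizontal).

Lemma edgeE_neq_edgeW p : edgeE R p != edgeW R p.
Proof. by apply/eqP; rewrite !edge_coord => -[]; lra. Qed.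

Lemma edgeN_neq_edgeS p : edgeN R p != edgeS R p.
Proof. by apply/eqP; rewrite !edge_coord => -[]; lra. Qed.

Lemma edgeE_eq_edgeW p q : edgeE R p = edgeW R q -> q.1 = p.1 + 1.
Proof.
rewrite !edge_coord => -[/eqP + _].
by rewrite -[1]/(1%:~R) -intrD eqr_int => /eqP.
Qed.

End Lattice.

(** * Edge-face incidence, the count of equations and the boundary flux *)

Section Incidence.
Variables (R : realType) (Omega : {fset int * int}).
Implicit Types (p q : int * int) (z : R[i]).

Definition edge_image (e : int * int -> R[i]) : {fset R[i]} :=
  [fset e p | p in Omega]%fset.

Lemma edge_imageP e z :
  reflect (exists2 p, p \in Omega & z = e p) (z \in edge_image e).
Proof. exact: imfsetP. Qed.

Lemma face_edgesP p z :
  (z \in face_edges R p) =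
  [|| z == edgeE R p, z == edgeN R p, z == edgeW R p | z == edgeS R p].
Proof. by rewrite !inE -!orbA. Qed.

Lemma edges_face p z : p \in Omega -> z \in face_edges R p -> z \in edges R Omega.
Proof. by move=> pO zp; apply/bigfcupP; exists p; rewrite ?pO. Qed.

Lemma edgeE_in p : p \in Omega -> edgeE R p \in edges R Omega.
Proof. by move/edges_face; apply; rewrite face_edgesP eqxx. Qed.

Lemma edgeN_in p : p \in Omega -> edgeN R p \in edges R Omega.
Proof. by move/edges_face; apply; rewrite face_edgesP eqxx !orbT. Qed.

Lemma edgeW_in p : p \in Omega -> edgeW R p \in edges R Omega.
Proof. by move/edges_face; apply; rewrite face_edgesP eqxx !orbT. Qed.

Lemma edgeS_in p : p \in Omega -> edgeS R p \in edges R Omega.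
Proof. by move/edges_face; apply; rewrite face_edgesP eqxx !orbT. Qed.

Lemma edgesP z : z \in edges R Omega ->
  [|| z \in edge_image (edgeE R), z \in edge_image (edgeN R),
      z \in edge_image (edgeW R) | z \in edge_image (edgeS R)].
Proof.
case/bigfcupP => p; rewrite andbT face_edgesP => pO.
by case/or4P => /eqP ->; apply/or4P; [apply: Or41 | apply: Or42 | apply: Or43
  | apply: Or44]; apply/edge_imageP; exists p.
Qed.

(** Reindexes by edges, so that the four edge types can be compared termwise. *)
Lemma sum_faces_edges (V : nmodType) (e : int * int -> R[i]) (g : R[i] -> V) :
  injective e -> (forall p, p \in Omega -> e p \in edges R Omega) ->
  \sum_(p <- Omega) g (e p) =
  \sum_(z <- edges R Omega) g z *+ (z \in edge_image e).
Proof.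
move=> e_inj e_edge.
have -> : \sum_(p <- Omega) g (e p) = \sum_(z <- edge_image e) g z.
  by rewrite big_imfset //= => p q _ _; apply: e_inj.
rewrite (eq_big_seq (fun z => g z *+ (z \in edge_image e))) /=; last first.
  by move=> z ->.
apply: big_fset_incl => [|z _ /negPf-> //].
by apply/fsubsetP => _ /edge_imageP[p pO ->]; apply: e_edge.
Qed.

(** The number of faces of [Omega] adjacent to [z]: an edge has each of the four positions in at
    most one face. *)
Definition incidence (z : R[i]) : nat :=
  ((z \in edge_image (edgeE R)) + (z \in edge_image (edgeN R))
   + (z \in edge_image (edgeW R)) + (z \in edge_image (edgeS R)))%N.

Lemma edge_image_direction z :
  [&& (z \in edge_image (edgeE R)) ==> vertical_edge z,
      (z \in edge_image (edgeW R)) ==> vertical_edge z,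
      (z \in edge_image (edgeN R)) ==> ~~ vertical_edge z &
      (z \in edge_image (edgeS R)) ==> ~~ vertical_edge z].
Proof.
by apply/and4P; split; apply/implyP => /edge_imageP[p _ ->];
  rewrite edge_direction.
Qed.

Lemma incidence_le2 z : (incidence z <= 2)%N.
Proof.
rewrite /incidence; have := edge_image_direction z.
by do 4!case: (z \in _); case: (vertical_edge z).
Qed.

Lemma sum_eq_mem (A : {fset R[i]}) z : (\sum_(x <- A) (z == x) = (z \in A))%N.
Proof.
rewrite -(count_uniq_mem _ (fset_uniq A)) -sum1_count [RHS]big_mkcond /=.
by apply: eq_bigr => x _; rewrite eq_sym; case: (x == z).
Qed.

Lemma sum_faces_eq (e : int * int -> R[i]) z : injective e ->
  (\sum_(p <- Omega) (z == e p) = (z \in edge_image e))%N.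
Proof.
move=> e_inj; rewrite -sum_eq_mem big_imfset //= => p q _ _; exact: e_inj.
Qed.

(** The four edges of a face are distinct, so a face containing [z] contributes exactly one to the
    incidence. *)
Lemma card_incident_faces z :
  #|` [fset p in Omega | z \in face_edges R p]%fset| = incidence z.
Proof.
rewrite /incidence -!sum_faces_eq; last first.
- exact: edgeE_inj.
- exact: edgeN_inj.
- exact: edgeW_inj.
- exact: edgeS_inj.
rewrite -!big_split /= card_fset_sum1 big_fset /= big_mkcond /=.
apply: eq_bigr => p _; rewrite face_edgesP.
have [->|] := eqVneq z (edgeE R p).
  have dN : edgeE R p != edgeN R p.
    by apply: contraTneq (edgeE_vertical R p) => ->; rewrite edge_direction.
  have dS : edgeE R p != edgeS R p.
    by apply: contraTneq (edgeE_vertical R p) => ->; rewrite edge_direction.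
  by rewrite (negPf dN) (negPf dS) (negPf (edgeE_neq_edgeW R p)).
have [-> _|] := eqVneq z (edgeN R p).
  have dW : edgeN R p != edgeW R p.
    rewrite eq_sym.
    by apply: contraTneq (edgeW_vertical R p) => ->; rewrite edge_direction.
  by rewrite (negPf dW) (negPf (edgeN_neq_edgeS R p)).
have [-> _ _|] := eqVneq z (edgeW R p).
  have dS : edgeW R p != edgeS R p.
    by apply: contraTneq (edgeW_vertical R p) => ->; rewrite edge_direction.
  by rewrite (negPf dS).
by case: (z == edgeS R p).
Qed.

Lemma boundary_edgesE z :
  (z \in boundary_edges R Omega) = (z \in edges R Omega) && (incidence z == 1)%N.
Proof. by rewrite !inE card_incident_faces. Qed.

(** Double counting: the incidences add up to four per face, and an incidence, plus one when it
    equals 1, is at most 2. *)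
Lemma card_equations_le :
  (#|` Omega| * 4 + #|` boundary_edges R Omega| <= #|` edges R Omega| * 2)%N.
Proof.
have -> : (#|` Omega| * 4 = \sum_(z <- edges R Omega) incidence z)%N.
  rewrite /incidence !big_split /=.
  have cardE e : injective e -> (forall p, p \in Omega -> e p \in edges R Omega) ->
      (\sum_(z <- edges R Omega) (z \in edge_image e) = #|` Omega|)%N.
    move=> e_inj e_edge; rewrite card_fset_sum1.
    apply: esym; apply: etrans (sum_faces_edges (fun=> 1%N) e_inj e_edge) _.
    by apply: eq_bigr => z _; rewrite natn.
  rewrite !cardE; last first.
  - exact: edgeE_in.
  - exact: edgeE_inj.
  - exact: edgeN_in.
  - exact: edgeN_inj.
  - exact: edgeW_in.
  - exact: edgeW_inj.
  - exact: edgeS_in.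
  - exact: edgeS_inj.
  by rewrite !mulnS muln0 addn0 !addnA.
have -> : (#|` boundary_edges R Omega| =
           \sum_(z <- edges R Omega) (incidence z == 1))%N.
  rewrite card_fset_sum1 /boundary_edges big_fset /= big_mkcond /=.
  by apply: eq_bigr => z _; rewrite card_incident_faces; case: (_ == _).
rewrite -big_split /= card_fset_sum1 big_distrl /=.
apply: leq_sum => z _.
by have := incidence_le2 z; case: (incidence z) => [|[|[|]]].
Qed.

(* [f] stands for F^2.  Interior edges cancel: the clockwise tangents of the
   two faces they separate are opposite. *)
Lemma boundary_flux (A B : R[i] -> R) (f : R[i] -> R[i]) :
  (forall z, f z = (A z +i* B z)%C) ->
  \sum_(p <- Omega) (B (edgeE R p) + A (edgeN R p) - B (edgeW R p) - A (edgeS R p))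
  = \sum_(z <- boundary_edges R Omega) complex.Re (f z * tau_cw Omega z).
Proof.
move=> fE; rewrite !sumrB !big_split /=.
rewrite (sum_faces_edges B (@edgeE_inj R) edgeE_in).
rewrite (sum_faces_edges A (@edgeN_inj R) edgeN_in).
rewrite (sum_faces_edges B (@edgeW_inj R) edgeW_in).
rewrite (sum_faces_edges A (@edgeS_inj R) edgeS_in).
rewrite -big_split -!sumrB /= big_fset /= [RHS]big_mkcond /=.
apply: eq_big_seq => z zE; rewrite card_incident_faces /incidence /tau_cw.
have := edgesP zE; have := edge_image_direction z; rewrite fE /edge_image.
(* For tau = -i, 1, i, -1 the real part of (A + iB) tau is B, A, -B, -A; an edge lying in two faces
   gets two opposite terms. *)
by do 4!case: (z \in _); case: (vertical_edge z) => //= _ _; ring.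
Qed.

Lemma tau_cw_expr4 z : tau_cw Omega z ^+ 4 = 1.
Proof.
have i4 : ('i%C : R[i]) ^+ 4 = 1 by rewrite (exprM _ 2 2) sqr_i sqrrN expr1n.
rewrite /tau_cw; case: ifP => _; first by rewrite (exprM _ 2 2) sqrrN -exprM.
case: ifP => _; first by rewrite expr1n.
by case: ifP => _; rewrite ?i4 // (exprM _ 2 2) sqrrN !expr1n.
Qed.

End Incidence.

(** * The s-holomorphicity equations in real form *)

Section CornerProjections.
Variable R : realType.
Implicit Types (F G : R[i]) (m n k : R).

(* The real part of F + (m + i n) conj F. *)
Definition corner_part (m n : R) (F : R[i]) : R :=
  (1 + m) * complex.Re F + n * complex.Im F.

(* When |m + i n| = 1, the values of F + (m + i n) conj F lie on a real line,
   which is not vertical when m <> -1. *)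
Lemma corner_eqP m n F G : m ^+ 2 + n ^+ 2 = 1 -> m != -1 ->
  F + (m +i* n)%C * F^*%C = G + (m +i* n)%C * G^*%C <->
  corner_part m n F = corner_part m n G.
Proof.
case: F G => [x y] [x' y'] mn m1; rewrite /corner_part /= !complexE_rules.
split=> [[+ _]|eqFG]; first by lra.
congr Complex; first by lra.
(* Multiplied by 1 + m, the imaginary part becomes n times the real part. *)
have m1' : 1 + m != 0 by rewrite addrC addr_eq0.
apply: (mulfI m1'); apply/subr0_eq.
have n2 : n ^+ 2 = (1 + m) * (1 - m) by lra.
transitivity (n * ((1 + m) * x + n * y - ((1 + m) * x' + n * y'))).
  by ring: n2.
by rewrite eqFG subrr mulr0.
Qed.

Lemma sqrt2_sqr : Num.sqrt 2 ^+ 2 = 2 :> R.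
Proof. by rewrite sqr_sqrtr. Qed.

Lemma sqrt2_bounds : 0 < Num.sqrt (2 : R) < 2.
Proof.
have r0 : 0 < Num.sqrt 2 :> R by rewrite sqrtr_gt0.
by have := sqrt2_sqr; rewrite r0 /=; nra.
Qed.

Lemma cos_piquarter : cos (pi / 4) = sin (pi / 4) :> R.
Proof. by rewrite -cosBpihalf -cosN; congr cos; field. Qed.

Lemma sin_piquarter : sin (pi / 4) = Num.sqrt 2 / 2 :> R.
Proof.
have pi0 := pi_gt0 R.
have s0 : 0 <= sin (pi / 4) :> R.
  by apply: sin_ge0_pi; apply/andP; split; lra.
have /andP[r0 _] := sqrt2_bounds.
have r0' : 0 <= Num.sqrt 2 / 2 :> R by lra.
apply/eqP; rewrite -(@eqrXn2 _ 2) //.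
rewrite expr_div_n sqrt2_sqr; apply/eqP.
by have := cos2Dsin2 (pi / 4 : R); rewrite cos_piquarter; lra.
Qed.

Lemma lambdaE : lambda R = (Num.sqrt 2 / 2 +i* (Num.sqrt 2 / 2))%C.
Proof. by rewrite /lambda cos_piquarter sin_piquarter. Qed.

Lemma lambdaVE : (lambda R)^-1 = (Num.sqrt 2 / 2 -i* (Num.sqrt 2 / 2))%C.
Proof.
have r2 := sqrt2_sqr.
apply/esym/(@divr1_eq R[i]); rewrite invrK lambdaE complexE_rules.
by congr Complex; field: r2.
Qed.

Lemma lambdaX3E : lambda R ^+ 3 = (- (Num.sqrt 2 / 2) +i* (Num.sqrt 2 / 2))%C.
Proof.
have r2 := sqrt2_sqr.
by rewrite lambdaE !exprS expr0 mulr1 !complexE_rules; congr Complex; field: r2.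
Qed.

Lemma lambdaXN3E : lambda R ^- 3 = (- (Num.sqrt 2 / 2) -i* (Num.sqrt 2 / 2))%C.
Proof.
have r2 := sqrt2_sqr.
by rewrite -exprVn lambdaVE !exprS expr0 mulr1 !complexE_rules; congr Complex;
  field: r2.
Qed.

(** [r] stands for sqrt 2; as a variable it lets the algebra rest on r^2 = 2 alone. The sign
    patterns of (k, k) are those of lambda, lambda^-1, lambda^3, lambda^-3. *)
Definition face_corner_parts (r : R) (E N W S : R[i]) : Prop :=
  let k := r / 2 in
  [/\ corner_part k k N = corner_part k k E,
      corner_part k (- k) N = corner_part k (- k) W,
      corner_part (- k) k S = corner_part (- k) k E &
      corner_part (- k) (- k) S = corner_part (- k) (- k) W].

Lemma face_equationsP E N W S :
  [/\ N + lambda R * N^*%C = E + lambda R * E^*%C,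
      N + (lambda R)^-1 * N^*%C = W + (lambda R)^-1 * W^*%C,
      S + lambda R ^+ 3 * S^*%C = E + lambda R ^+ 3 * E^*%C &
      S + lambda R ^- 3 * S^*%C = W + lambda R ^- 3 * W^*%C] <->
  face_corner_parts (Num.sqrt 2) E N W S.
Proof.
have r2 := sqrt2_sqr; have /andP[r0 r1] := sqrt2_bounds.
rewrite lambdaVE lambdaXN3E lambdaX3E lambdaE /face_corner_parts.
by split=> -[e1 e2 e3 e4]; split; apply/corner_eqP => //;
  first [by field: r2 | by apply/eqP; lra].
Qed.

(** Add and subtract the two equations at N, and those at S. Since 2 k^2 = 1, the inverses of 2(1 +
    k), 2(1 - k) and 2k are 1 - k, 1 + k and k. *)
Lemma face_solve r E N W S (r2 : r ^+ 2 = 2) : let k := r / 2 in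
  face_corner_parts r E N W S ->
  [/\ complex.Re N = (1 - k) * (corner_part k k E + corner_part k (- k) W),
      complex.Im N = k * (corner_part k k E - corner_part k (- k) W),
      complex.Re S = (1 + k) * (corner_part (- k) k E + corner_part (- k) (- k) W) &
      complex.Im S = k * (corner_part (- k) k E - corner_part (- k) (- k) W)].
Proof.
move=> k [<- <- <- <-]; rewrite /corner_part /k.
by split; field: r2.
Qed.

(* The left-hand side is the real part of the clockwise sum of F^2 tau over the
   edges of the face, with tau = -i, 1, i, -1 on E, N, W, S. *)
Lemma face_flux r E N W S : r ^+ 2 = 2 -> face_corner_parts r E N W S ->
  complex.Im (E ^+ 2) + complex.Re (N ^+ 2) - complex.Im (W ^+ 2)
    - complex.Re (S ^+ 2)
  = - r * ((complex.Re E - complex.Re W) ^+ 2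
           + (complex.Im E - complex.Im W) ^+ 2).
Proof.
move=> r2 /(face_solve r2) [].
case: E N W S => [xE yE] [xN yN] [xW yW] [xS yS].
rewrite !expr2 /corner_part /= => -> -> -> ->.
by field: r2.
Qed.

End CornerProjections.

(** * Energy identity and vanishing of the homogeneous solution *)

Section Uniqueness.
Variables (R : realType) (Omega : {fset int * int}).
Implicit Types (z f w tau : R[i]).

Definition invsqrt_tau z : R[i] := sqrtc (tau_cw Omega z)^-1.

(** As tau^4 = 1, this is an eighth root of unity. *)
Lemma invsqrt_tau_norm z :
  complex.Re (invsqrt_tau z) ^+ 2 + complex.Im (invsqrt_tau z) ^+ 2 = 1.
Proof.
have w8 : invsqrt_tau z ^+ 8 = 1.
  by rewrite (exprM _ 2 4) sqr_sqrtc exprVn tau_cw_expr4 invr1.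
have w1 : `|invsqrt_tau z| = 1.
  by apply/eqP; rewrite -(@pexpr_eq1 _ _ 8) // -normrX w8 normr1.
by have := add_Re2_Im2 (invsqrt_tau z); rewrite w1 expr1n => -[].
Qed.

(* [f] is a real multiple of a unit complex number [w] iff this vanishes. *)
Definition cross w f : R :=
  complex.Re w * complex.Im f - complex.Im w * complex.Re f.

Lemma parallel_tauP f z :
  parallel_invsqrt f (tau_cw Omega z) <-> cross (invsqrt_tau z) f = 0.
Proof.
have := invsqrt_tau_norm z; have : invsqrt_tau z ^+ 2 = (tau_cw Omega z)^-1.
  exact: sqr_sqrtc.
move: (invsqrt_tau z) => w wtau w1; rewrite /cross /parallel_invsqrt.
split=> [[w' [r [w'tau ->]]]|f0].
  have /eqP : w' ^+ 2 = w ^+ 2 by rewrite w'tau.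
  by rewrite eqf_sqr => /orP[] /eqP ->; case: (w) => c d /=; ring.
(* The coefficient of [f] along the unit vector [w] is their real scalar product. *)
exists w, (complex.Re w * complex.Re f + complex.Im w * complex.Im f).
split=> //; case: f w w1 {wtau} f0 => [x y] [a b] /= w1 /subr0_eq/esym bx.
rewrite complexE_rules -[in LHS](mul1r x) -[in LHS](mul1r y) -w1.
by congr Complex; ring: bx.
Qed.

(** With w = tau^(-1/2) of modulus 1, f^2 tau is the square of f times the conjugate of w, a real
    number of modulus |f|. *)
Lemma Re_sqr_tau f z : cross (invsqrt_tau z) f = 0 ->
  complex.Re (f ^+ 2 * tau_cw Omega z) =
  complex.Re f ^+ 2 + complex.Im f ^+ 2.
Proof.
have := invsqrt_tau_norm z.
have -> : tau_cw Omega z = (invsqrt_tau z ^+ 2)^-1.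
  by rewrite /invsqrt_tau sqr_sqrtc invrK.
move: (invsqrt_tau z) => w w1 /subr0_eq fw.
have wJ : w^-1 = w^*%C.
  apply/esym/(@divr1_eq R[i]); rewrite invrK.
  case: (w) w1 => a b /= w1; rewrite complexE_rules.
  by congr Complex; last ring; rewrite -w1; ring.
rewrite -exprVn wJ -exprMn; case: f w w1 fw {wJ} => [x y] [a b] /= w1 ay.
rewrite expr2 -[RHS]mulr1 -[in RHS]w1 /=; ring: ay.
Qed.

Variable H : R[i] -> R[i].
Hypothesis H_face : forall p, p \in Omega -> face_corner_parts (Num.sqrt 2)
  (H (edgeE R p)) (H (edgeN R p)) (H (edgeW R p)) (H (edgeS R p)).
Hypothesis H_boundary : forall z, z \in boundary_edges R Omega ->
  cross (invsqrt_tau z) (H z) = 0.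

Let jump p : R :=
  (complex.Re (H (edgeE R p)) - complex.Re (H (edgeW R p))) ^+ 2
  + (complex.Im (H (edgeE R p)) - complex.Im (H (edgeW R p))) ^+ 2.

Let sqr_norm z : R := complex.Re (H z) ^+ 2 + complex.Im (H z) ^+ 2.

Lemma energy_identity :
  \sum_(z <- boundary_edges R Omega) sqr_norm z
  + Num.sqrt 2 * \sum_(p <- Omega) jump p = 0.
Proof.
have := @boundary_flux R Omega (fun z => complex.Re (H z ^+ 2))
  (fun z => complex.Im (H z ^+ 2)) (fun z => H z ^+ 2).
have HE z : H z ^+ 2 = (complex.Re (H z ^+ 2) +i* complex.Im (H z ^+ 2))%C.
  by case: (H z ^+ 2).
move=> /(_ HE) flux.
rewrite mulr_sumr; apply/eqP; rewrite addr_eq0 -sumrN; apply/eqP.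
transitivity (\sum_(z <- boundary_edges R Omega)
    complex.Re (H z ^+ 2 * tau_cw Omega z)).
  by apply: eq_big_seq => z zB; rewrite Re_sqr_tau //; apply: H_boundary.
rewrite -flux; apply: eq_big_seq => p pO.
by rewrite (face_flux (sqrt2_sqr R) (H_face pO)) mulNr.
Qed.

Lemma sqr_sum_eq0 (x y : R) : x ^+ 2 + y ^+ 2 = 0 -> x = 0 /\ y = 0.
Proof.
move/eqP; rewrite paddr_eq0 ?sqr_ge0 // !sqrf_eq0.
by move=> /andP[/eqP-> /eqP->].
Qed.

Lemma sum_seq_eq0 (T : eqType) (s : seq T) (F : T -> R) :
  (forall x, 0 <= F x) -> \sum_(x <- s) F x = 0 ->
  forall x, x \in s -> F x = 0.
Proof.
move=> F0 /eqP; rewrite psumr_eq0 // => /allP sF x xs.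
by apply/eqP; have := sF x xs.
Qed.

Lemma energy_parts_eq0 :
  (forall z, z \in boundary_edges R Omega -> H z = 0) /\
  (forall p, p \in Omega -> H (edgeE R p) = H (edgeW R p)).
Proof.
have jump_ge0 p : 0 <= jump p by rewrite addr_ge0 ?sqr_ge0.
have sqr_norm_ge0 z : 0 <= sqr_norm z by rewrite addr_ge0 ?sqr_ge0.
have /andP[r0 _] := sqrt2_bounds R.
have /eqP := energy_identity; rewrite paddr_eq0; last 2 first.
- by rewrite sumr_ge0.
- by rewrite mulr_ge0 ?sqrtr_ge0 ?sumr_ge0.
rewrite mulf_eq0 (gt_eqF r0) /= => /andP[/eqP sB /eqP sJ].
split=> [z zB|p pO].
  have := sum_seq_eq0 sqr_norm_ge0 sB zB => /sqr_sum_eq0.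
  by case: (H z) => x y /= [-> ->].
have := sum_seq_eq0 jump_ge0 sJ pO => /sqr_sum_eq0[] /subr0_eq + /subr0_eq.
by case: (H (edgeE R p)) (H (edgeW R p)) => [x y] [x' y'] /= -> ->.
Qed.

(** Among the faces with a nonzero east value, take one in the rightmost column. Its east edge is
    not on the boundary, so it is the west edge of a face one column further right, whose east value
    is the same: a contradiction. *)
Lemma right_edge_eq0 p : p \in Omega -> H (edgeE R p) = 0.
Proof.
have [H_bd H_EW] := energy_parts_eq0.
move=> pO; apply: contrapT => Hp.
have Hp' : [pred q : Omega | H (edgeE R (val q)) != 0] [` pO]%fset.
  by rewrite /=; apply/eqP.
case: (Order.TotalTheory.arg_maxP (fun q : Omega => (val q).1) Hp') => q Hq qmax.
have qO := valP q.
have edge_q := edgeE_in R qO.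
have : edgeE R (val q) \in boundary_edges R Omega ->
  H (edgeE R (val q)) = 0 by apply: H_bd.
rewrite boundary_edgesE edge_q /=; have := edge_image_direction Omega (edgeE R (val q)).
have q_in : edgeE R (val q) \in edge_image Omega (edgeE R).
  by apply/edge_imageP; exists (val q).
(* The edge is vertical, so its incidence is 1 unless it is also a west edge. *)
rewrite /incidence q_in edge_direction /= !implybF => /and3P[_ /negPf-> /negPf->].
case: (boolP (_ \in _)) => [/edge_imageP[q' q'O qq'] _|_ /(_ isT)]; last first.
  by move=> Hq0; move: Hq; rewrite /= Hq0 eqxx.
have Hq' : [pred q : Omega | H (edgeE R (val q)) != 0] [` q'O]%fset.
  by rewrite /= H_EW // -qq'.
have := qmax _ Hq'; rewrite /= (edgeE_eq_edgeW qq').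
by rewrite gerDl.
Qed.

(** East and west values vanish, and they determine the north and south ones linearly. *)
Lemma s_holomorphic_eq0 z : z \in edges R Omega -> H z = 0.
Proof.
have [_ H_EW] := energy_parts_eq0.
case/bigfcupP => p; rewrite andbT face_edgesP => pO.
have HE := right_edge_eq0 pO.
have HW : H (edgeW R p) = 0 by rewrite -H_EW.
have := face_solve (sqrt2_sqr R) (H_face pO).
rewrite HE HW /corner_part /= !(mulr0, addr0, subr0) => -[xN yN xS yS].
have eq0 f : complex.Re f = 0 -> complex.Im f = 0 -> f = 0.
  by case: f => x y /= -> ->.
by case/or4P => /eqP ->; rewrite ?HE ?HW //; apply: eq0.
Qed.

End Uniqueness.

(** * Surjectivity of the real linear system by a dimension count *)

Lemma linear_inj_surj (K : fieldType) (I J : finType)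
    (f : {ffun I -> K^o} -> {ffun J -> K^o}) :
  linear f -> (forall x, f x = 0 -> x = 0) -> (#|J| <= #|I|)%N ->
  forall y, exists x, f x = y.
Proof.
move=> f_lin f_ker leJI y.
pose fM := GRing.isLinear.Build _ _ _ _ f f_lin.
pose fL : {linear _ -> _} := HB.pack f fM.
have ker0 : lker (linfun fL) == 0%VS.
  rewrite -subv0; apply/subvP => x; rewrite memv_ker lfunE /= memv0.
  by move=> /eqP/f_ker ->.
(* By rank-nullity the image has dimension [#|I|], at least [#|J|]. *)
have full : limg (linfun fL) = fullv.
  apply/eqP; rewrite eqEdim subvf /= limg_dim_eq; last first.
    by rewrite (eqP ker0) capv0.
  by rewrite !dimvf /dim /= !muln1.
have /memv_imgP[x _ ->] : y \in limg (linfun fL) by rewrite full memvf.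
by exists x; rewrite lfunE.
Qed.

Section Existence.
Variables (R : realType) (Omega : {fset int * int}).
Let E : finType := edges R Omega.

(** The left and right copies of [E] index real and imaginary parts; the value off the edges is
    0. *)
Definition field_of (x : {ffun E + E -> R^o}) (z : R[i]) : R[i] :=
  if insub z is Some e then (x (inl e) +i* x (inr e))%C else 0.

Definition equation_index : finType :=
  (Omega * (bool * bool) + boundary_edges R Omega)%type.

(* In an index (p, (i, j)), i selects N or S and j selects E or W; the power of
   lambda attached to that corner is (+-1 +- i) / sqrt 2, with these signs. *)
Definition signed_half (s : bool) : R :=
  if s then Num.sqrt 2 / 2 else - (Num.sqrt 2 / 2).

Definition equations (x : {ffun E + E -> R^o}) : {ffun equation_index -> R^o} :=
  [ffun j : equation_index => match j with
   | inl (p, (i, j)) =>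
       let part := corner_part (signed_half i) (signed_half j) in
       part (field_of x (if i then edgeN R (val p) else edgeS R (val p)))
       - part (field_of x (if j then edgeE R (val p) else edgeW R (val p)))
   | inr z => cross (invsqrt_tau Omega (val z)) (field_of x (val z))
   end].

Lemma field_of_val x (e : E) : field_of x (val e) = (x (inl e) +i* x (inr e))%C.
Proof. by rewrite /field_of valK. Qed.

Lemma field_of_linear (a : R) x y z :
  field_of (a *: x + y) z =
  ((a * complex.Re (field_of x z) + complex.Re (field_of y z))
   +i* (a * complex.Im (field_of x z) + complex.Im (field_of y z)))%C.
Proof.
rewrite /field_of; case: insubP => [e _ _|_] /=; first by rewrite !ffunE.
by rewrite mulr0 addr0.
Qed.

Lemma equations_linear : linear equations.
Proof.
move=> a x y; apply/ffunP => -[[p [i j]]|z]; rewrite !ffunE.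
  by case: i j => -[]; rewrite /corner_part !field_of_linear /=
    -[a *: _]/(a * _); ring.
by rewrite /cross field_of_linear /= -[a *: _]/(a * _); ring.
Qed.

Lemma equations_face x : (forall j, equations x (inl j) = 0) ->
  forall p, p \in Omega -> face_corner_parts (Num.sqrt 2)
    (field_of x (edgeE R p)) (field_of x (edgeN R p))
    (field_of x (edgeW R p)) (field_of x (edgeS R p)).
Proof.
move=> x0 p pO; have eq0 i j := x0 ([` pO]%fset, (i, j)).
split; apply: subr0_eq; [move: (eq0 true true) | move: (eq0 true false)
  | move: (eq0 false true) | move: (eq0 false false)]; by rewrite ffunE.
Qed.

Lemma equations_ker x : equations x = 0 -> x = 0.
Proof.
move=> x0; have eq0 j : equations x j = 0 by rewrite x0 ffunE.
have H0 : forall z, z \in edges R Omega -> field_of x z = 0.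
  apply: s_holomorphic_eq0; first exact: equations_face.
  by move=> z zB; have := eq0 (inr [` zB]%fset); rewrite ffunE.
apply/ffunP => -[] e; have := H0 _ (valP e); rewrite field_of_val ffunE.
  by case.
by case.
Qed.

Lemma equations_surj y : exists x, equations x = y.
Proof.
apply: linear_inj_surj; first exact: equations_linear.
  exact: equations_ker.
rewrite !card_sum !card_prod !card_bool -!cardfE addnn -muln2.
exact: card_equations_le.
Qed.

End Existence.

(** * The boundary value problem for s-holomorphic functions *)

Section Extension.
Variables (R : realType) (Omega : {fset int * int}).
Implicit Types (h : {ffun edges R Omega -> R[i]}).

(** Total on the plane, so that evaluating at an edge takes no membership proof. *)
Definition extend0 h (z : R[i]) : R[i] := if insub z is Some e then h e else 0.

Lemma extend0_val h e : extend0 h (val e) = h e.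
Proof. by rewrite /extend0 valK. Qed.

Lemma s_holomorphicP h : s_holomorphic h <->
  forall p, p \in Omega -> face_corner_parts (Num.sqrt 2)
    (extend0 h (edgeE R p)) (extend0 h (edgeN R p))
    (extend0 h (edgeW R p)) (extend0 h (edgeS R p)).
Proof.
split=> h_hol p pO => [|E N W S EE NE WE SE].
  have := h_hol p pO [` edgeE_in R pO]%fset [` edgeN_in R pO]%fset
    [` edgeW_in R pO]%fset [` edgeS_in R pO]%fset erefl erefl erefl erefl.
  by rewrite -!extend0_val => /face_equationsP.
by apply/face_equationsP; rewrite -!extend0_val EE NE WE SE; apply: h_hol.
Qed.

Lemma corner_partB (m n : R) (f g : R[i]) :
  corner_part m n (f - g) = corner_part m n f - corner_part m n g.
Proof. by case: f g => [x y] [x' y']; rewrite /corner_part /=; ring. Qed.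

Lemma crossB (w f g : R[i]) : cross w (f - g) = cross w f - cross w g.
Proof. by case: f g => [x y] [x' y']; rewrite /cross /=; ring. Qed.

Lemma extend0B h h' z : extend0 (h - h') z = extend0 h z - extend0 h' z.
Proof.
by rewrite /extend0; case: insubP => [e _ _|_]; rewrite ?subr0 // !ffunE.
Qed.

Lemma s_holomorphicB h h' :
  s_holomorphic h -> s_holomorphic h' -> s_holomorphic (h - h').
Proof.
move=> /s_holomorphicP h_hol /s_holomorphicP h'_hol.
apply/s_holomorphicP => p pO; have [e1 e2 e3 e4] := h_hol p pO.
have [e1' e2' e3' e4'] := h'_hol p pO.
by split; rewrite !extend0B !corner_partB ?e1 ?e2 ?e3 ?e4 ?e1' ?e2' ?e3' ?e4'.
Qed.

(** The difference solves the homogeneous problem, hence vanishes. *)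
Lemma s_holomorphic_inj h h' : s_holomorphic h -> s_holomorphic h' ->
  (forall e : edges R Omega, val e \in boundary_edges R Omega ->
     parallel_invsqrt (h e - h' e) (tau_cw Omega (val e))) ->
  h = h'.
Proof.
move=> h_hol h'_hol h_bd; apply/subr0_eq/ffunP => e.
rewrite [RHS]ffunE -extend0_val; apply: s_holomorphic_eq0 (valP e) => [|z zB].
  exact/s_holomorphicP/s_holomorphicB.
have zE : z \in edges R Omega by move: zB; rewrite boundary_edgesE => /andP[].
apply/parallel_tauP; have := h_bd [` zE]%fset zB.
by rewrite extend0B -(extend0_val h) -(extend0_val h').
Qed.

Lemma parallel_invsqrtB (f g z : R[i]) :
  parallel_invsqrt f (tau_cw Omega z) -> parallel_invsqrt g (tau_cw Omega z) ->
  parallel_invsqrt (f - g) (tau_cw Omega z).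
Proof.
move=> /parallel_tauP f0 /parallel_tauP g0; apply/parallel_tauP.
by rewrite crossB f0 g0 subrr.
Qed.

Lemma s_holomorphic_boundary_value (g : R[i] -> R[i]) :
  exists h, s_holomorphic h /\
    forall e : edges R Omega, val e \in boundary_edges R Omega ->
      parallel_invsqrt (h e - g (val e)) (tau_cw Omega (val e)).
Proof.
(* Zero on the face equations imposes s-holomorphicity; the boundary entries prescribe the component
   of [h] orthogonal to tau_cw^(-1/2) to be that of [g]. *)
pose y : {ffun equation_index R Omega -> R^o} :=
  [ffun j => if j is inr z then cross (invsqrt_tau Omega (val z)) (g (val z))
             else 0].
have [x xy] := equations_surj y.
exists [ffun e => field_of x (val e)].
have extE z : z \in edges R Omega ->
    extend0 [ffun e => field_of x (val e)] z = field_of x z.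
  by move=> zE; rewrite -[z]/(val [` zE]%fset) extend0_val ffunE.
split=> [|e eB].
  apply/s_holomorphicP => p pO.
  rewrite !extE ?edgeE_in ?edgeN_in ?edgeW_in ?edgeS_in //.
  by apply: equations_face pO => j; rewrite xy ffunE.
apply/parallel_tauP; rewrite crossB ffunE; apply/eqP; rewrite subr_eq0; apply/eqP.
by move/ffunP: xy => /(_ (inr [` eB]%fset)); rewrite !ffunE.
Qed.

End Extension.

Theorem lemma28 (R : realType) (Omega : {fset int * int})
    (b : {fset R[i]}) (u : {ffun b -> R[i]}) :
  square_grid_domain R Omega ->
  (b `<=` boundary_edges R Omega)%fset ->
  Rspace Omega b u ->
  exists! v : {ffun b -> R[i]},
    Ispace Omega b v /\
    exists h : {ffun edges R Omega -> R[i]},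
      [/\ s_holomorphic h,
          extends h (u + v) &
          forall z : edges R Omega,
            val z \in boundary_edges R Omega -> val z \notin b ->
            parallel_invsqrt (h z) (tau_cw Omega (val z))].
Proof.
move=> _ b_bd _.
(* With datum [u] on [b] and 0 elsewhere, one boundary problem encodes both requirements: h - u is
   parallel to tau_cw^(-1/2) on [b], and [h] itself on the other boundary edges. *)
pose g (z : R[i]) : R[i] := if insub z is Some c then u c else 0.
have [h [h_hol h_bd]] := s_holomorphic_boundary_value Omega g.
have b_edge (c : b) : val c \in edges R Omega.
  by have := fsubsetP b_bd _ (valP c); rewrite boundary_edgesE => /andP[].
pose v := [ffun c : b => h [` b_edge c]%fset - u c].
have vI : Ispace Omega b v.
  move=> c; rewrite ffunE.
  have := h_bd [` b_edge c]%fset (fsubsetP b_bd _ (valP c)).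
  by rewrite /g valK.
have h_ext : extends h (u + v).
  move=> c e ec; rewrite !ffunE addrC subrK; congr (h _); exact: val_inj.
have h_off (e : edges R Omega) : val e \in boundary_edges R Omega ->
    val e \notin b -> parallel_invsqrt (h e) (tau_cw Omega (val e)).
  move=> eB eb; have := h_bd e eB.
  by rewrite /g insubF ?subr0 //; apply: negPf.
exists v; split=> [|v' [v'I [h' [h'_hol h'_ext h'_off]]]].
  by split=> //; exists h.
(* On [b] the difference of the extensions is v - v', parallel to tau_cw^(-1/2); on the other
   boundary edges both extensions are. *)
have hh' : h = h'.
  apply: s_holomorphic_inj => // e eB.
  have [eb|eb] := boolP (val e \in b); last first.
    by apply: parallel_invsqrtB; [apply: h_off | apply: h'_off].
  rewrite (h_ext [` eb]%fset e erefl) (h'_ext [` eb]%fset e erefl).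
  rewrite [(u + v) _]ffunE [(u + v') _]ffunE opprD addrACA subrr add0r.
  exact: parallel_invsqrtB (vI [` eb]%fset) (v'I [` eb]%fset).
apply/ffunP => c; apply: (addrI (u c)).
have := h'_ext c [` b_edge c]%fset erefl.
have := h_ext c [` b_edge c]%fset erefl.
by rewrite hh' [(u + v) c]ffunE [(u + v') c]ffunE => -> ->.
Qed.
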